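(* A reduced algebra of sets $(X,\mathcal{M})$ is a $\sigma$-algebra if and only if $(X,\delta_{\mathcal{M}})$ is a $P_{\aleph_{1}}$-proximity space.
   Context: A proximity space is a pair $(X,\delta)$ where $X$ is a set and $\delta$ is a relation on the power set $P(X)$ (with negation $\overline{\delta}$) such that: (1) $A\delta B$ implies $B\delta A$; (2) $(A\cup B)\delta C$ iff $A\delta C$ or $B\delta C$; (3) $A\delta B$ implies $A\neq\emptyset$ and $B\neq\emptyset$; (4) if $A\overline{\delta}B$, then there is a set $E\subseteq X$ with $A\overline{\delta}E$ and $E^{c}\overline{\delta}B$; (5) if $A\cap B\neq\emptyset$, then $A\delta B$. It is separated if $\{x\}\delta\{y\}$ implies $x=y$. Here $A^c$ denotes the complement. A separated proximity space $(X,\delta)$ is a $P_{\aleph_{1}}$-proximity space if whenever $A_{n}\subseteq X$ for $n\in\mathbb{N}$, $B\subseteq X$ and $\left(\bigcup_{n}A_{n}\right)\delta B$, then $A_{n}\delta B$ for some $n$. An algebra of sets $(X,\mathcal{M})$ is a set $X$ with a family $\mathcal{M}$ of subsets of $X$ that contains $X$ and is closed under complements and finite unions. It is reduced if whenever $x,y\in X$ are distinct there is $R\in\mathcal{M}$ with $x\in R$, $y\in R^{c}$. For an algebra of sets $(X,\mathcal{M})$, $\delta_{\mathcal{M}}$ is the relation on $P(X)$ given by: $U\overline{\delta_{\mathcal{M}}}V$ iff there is some $R\in\mathcal{M}$ with $U\subseteq R$ and $V\subseteq R^{c}$. *)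

(* Defs.v *)
From mathcomp Require Import all_boot.
From mathcomp Require Import boolp classical_sets measurable_structure.

Set Implicit Arguments.
Unset Strict Implicit.
Unset Printing Implicit Defensive.

Local Open Scope classical_set_scope.

(* The ambient set X is the whole (possibly empty) type T; [delta A B] reads
   "A is near B", and the negated relation is [~ delta A B]. *)
Record proximity (T : Type) (delta : set T -> set T -> Prop) : Prop := {
  proximity_sym : forall A B, delta A B -> delta B A;
  proximityU : forall A B C, delta (A `|` B) C <-> delta A C \/ delta B C;
  proximity_neq0 : forall A B, delta A B -> A <> set0 /\ B <> set0;
  proximity_strong : forall A B, ~ delta A B ->
    exists E : set T, ~ delta A E /\ ~ delta (~` E) B;
  proximityI : forall A B, A `&` B <> set0 -> delta A B
}.

Definition separated_proximity (T : Type) (delta : set T -> set T -> Prop) :=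
  proximity delta /\ forall x y : T, delta [set x] [set y] -> x = y.

Definition P_aleph1_proximity (T : Type) (delta : set T -> set T -> Prop) :=
  separated_proximity delta /\
  forall (A : nat -> set T) (B : set T),
    delta (\bigcup_n A n) B -> exists n, delta (A n) B.

Definition algebra_of_sets (T : Type) (M : set (set T)) :=
  [/\ M setT, setC_closed M & setU_closed M].

Definition reduced (T : Type) (M : set (set T)) :=
  forall x y : T, x <> y -> exists R : set T, [/\ M R, R x & (~` R) y].

Definition delta_of (T : Type) (M : set (set T)) (U V : set T) : Prop :=
  ~ exists R : set T, [/\ M R, U `<=` R & V `<=` ~` R].

(* Main.v *)
Require Import Defs.
From mathcomp Require Import all_boot.
From mathcomp Require Import boolp classical_sets measurable_structure.

(** Two sets are far for [delta_of M] when a member of [M] separates them.  For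
    an algebra this relation is always a proximity, because complements and
    finite unions of separating sets separate; it is separated because [M] is
    reduced.  Only the countable axiom is at stake, and it says exactly that [M]
    is closed under countable unions.

    If [M] is a sigma-algebra and [R n] separates [A n] from [B] for every [n],
    then the union of the [R n] separates the union of the [A n] from [B].
    Conversely, the only set that can separate a set from its complement is that
    set itself, so membership in [M] is a statement about the proximity: [U]
    belongs to [M] iff [U] is far from [~` U] ([far_setC]).  When every [A n]
    belongs to [M], it is far from its complement, hence from the smaller
    complement of the union; the countable axiom then makes the union far from
    its own complement, so that it belongs to [M]. *)

Set Implicit Arguments.
Unset Strict Implicit.
Unset Printing Implicit Defensive.

Local Open Scope classical_set_scope.

Section Separation.
Variables (T : Type) (M : set (set T)).
Implicit Types U V : set T.

Lemma farP U V :
  ~ delta_of M U V <-> exists R, [/\ M R, U `<=` R & V `<=` ~` R].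
Proof. by split=> [/contrapT|sep]; last exact. Qed.

Lemma far_subset U U' V V' :
  U `<=` U' -> V `<=` V' -> ~ delta_of M U' V' -> ~ delta_of M U V.
Proof.
move=> UU' VV' /farP[R [MR U'R V'R]]; apply/farP.
by exists R; split=> //; [exact: subset_trans U'R | exact: subset_trans V'R].
Qed.

(** A separator of [U] from [~` U] contains [U] and misses everything else, so
    it has no choice but to be [U]. *)
Lemma far_setC U : ~ delta_of M U (~` U) <-> M U.
Proof.
split=> [/farP[R [MR UR /subsetC]] | MU]; last first.
  by apply/farP; exists U; split.
by rewrite !setCK => RU; rewrite (_ : U = R) //; apply/seteqP.
Qed.

Hypothesis Malg : algebra_of_sets M.

Lemma far_sym U V : ~ delta_of M U V -> ~ delta_of M V U.
Proof.
case: Malg => _ MC _ /farP[R [MR UR VR]]; apply/farP.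
by exists (~` R); rewrite setCK; split=> //; exact: MC.
Qed.

Lemma delta_of_proximity : proximity (delta_of M).
Proof.
have [MT MC MU] := Malg; split.
- by move=> A B AB; apply: contrapT => /far_sym.
- move=> A B C; split=> [ABC|].
    apply: contrapT => /not_orP[/farP[R [MR AR CR]] /farP[S [MS BS CS]]].
    apply: ABC; exists (R `|` S); split; first exact: MU.
    + exact: setUSS.
    + by rewrite setCU subsetI.
  case=> near; apply: contrapT => farABC; apply: (far_subset _ _ farABC) near.
  + exact: subsetUl.
  + exact: subset_refl.
  + exact: subsetUr.
  + exact: subset_refl.
- have far0 A : ~ delta_of M set0 A.
    by apply: (far_subset (@sub0set _ _) (_ : A `<=` ~` set0));
      [rewrite setC0 | apply/far_setC; rewrite -setCT; exact: MC].
  move=> A B AB; split=> E; first by move: AB; rewrite E; exact: far0.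
  by move: AB; rewrite E; apply: far_sym; exact: far0.
- (* The complement of a separator interpolates between the two sets. *)
  move=> A B /farP[R [MR AR BR]]; exists (~` R); rewrite setCK.
  by split; apply/farP; exists R; split.
- move=> A B AB [R [_ AR BR]]; apply: AB.
  by rewrite -subset0 => x [/AR Rx /BR].
Qed.

Lemma delta_of_separated : reduced M -> separated_proximity (delta_of M).
Proof.
move=> Mred; split=> [|x y xy]; first exact: delta_of_proximity.
apply: contrapT => /Mred[R [MR Rx Ry]]; apply: xy.
by exists R; split=> // _ ->.
Qed.

End Separation.

Theorem theorem2p4 (T : Type) (M : set (set T))
    (Malg : algebra_of_sets M) (Mred : reduced M) :
  sigma_algebra setT M <-> P_aleph1_proximity (delta_of M).
Proof.
split=> [[_ _ Mbigcup]|[_ delta_bigcup]].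
  split=> [|A B AB]; first exact: delta_of_separated.
  apply: contrapT => /forallNP farA.
  have /choice[R RP] n := (farP M (A n) B).1 (farA n).
  apply: AB; exists (\bigcup_n R n); split.
  - by apply: Mbigcup => n; case: (RP n).
  - by apply: subset_bigcup => n _; case: (RP n).
  - by rewrite setC_bigcup; apply: sub_bigcap => n _; case: (RP n).
have [MT MC _] := Malg; split.
- by rewrite -setCT; exact: MC.
- by move=> A MA; rewrite setTD; exact: MC.
- move=> A MA; apply/far_setC => /delta_bigcup[n].
  apply: (far_subset (@subset_refl _ (A n)) (_ : _ `<=` ~` A n)).
  + by apply: subsetC; exact: bigcup_sup.
  + exact: (far_setC M (A n)).2 (MA n).
Qed.
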